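(* Let $T_1,T_2\in \mathcal{L}_A(\mathcal{H})$. Then $$w_A(T_1T_2)\leq \frac{1}{2}\left(\|T_2T_1\|_A+\|T_1\|_A\|T_2\|_A\right).$$
   Context: $\mathcal{H}$ is a complex Hilbert space with inner product $\langle\cdot,\cdot\rangle$, and $\mathcal{L}(\mathcal{H})$ is the algebra of bounded linear operators on $\mathcal{H}$. $A\in\mathcal{L}(\mathcal{H})$ is a fixed positive operator, i.e. $A=A^*$ and $\langle Ax,x\rangle\ge 0$ for all $x\in\mathcal{H}$ ($A$ need not be injective). Put $\langle x,y\rangle_A=\langle Ax,y\rangle$ and $\|x\|_A=\sqrt{\langle x,x\rangle_A}$ (a seminorm). $\mathcal{R}(\cdot)$ denotes the range, and $\mathcal{L}_A(\mathcal{H})=\{T\in\mathcal{L}(\mathcal{H}):\mathcal{R}(T^*A)\subseteq\mathcal{R}(A)\}$ (the operators admitting an $A$-adjoint, i.e. an $X\in\mathcal{L}(\mathcal{H})$ with $AX=T^*A$); it is a subalgebra of $\mathcal{L}(\mathcal{H})$. For $T\in\mathcal{L}_A(\mathcal{H})$ the $A$-operator seminorm is $\|T\|_A=\sup\{\|Tx\|_A/\|x\|_A : x\in\overline{\mathcal{R}(A)},\ x\ne 0\}$, and the $A$-numerical radius is $w_A(T)=\sup\{|\langle Tx,x\rangle_A| : x\in\mathcal{H},\ \|x\|_A=1\}$. *)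

(* Defs.v *)
From HB Require Import structures.
From mathcomp Require Import all_boot all_order all_algebra.
From mathcomp Require Import complex.
From mathcomp Require Import all_classical all_reals all_analysis.
From mathcomp Require Import ring lra.

Set Implicit Arguments.
Unset Strict Implicit.
Unset Printing Implicit Defensive.

Import Order.TTheory GRing.Theory Num.Theory.
Import numFieldNormedType.Exports.

Local Open Scope classical_set_scope.
Local Open Scope ring_scope.
Local Open Scope complex_scope.

(* The inner product is linear in its first argument and conjugate-linear in
   its second one. *)
HB.mixin Record CompleteNormedModule_isHilbert (R : realType) H
    & CompleteNormedModule R[i] H := {
  inner : {dot H for (@Num.conj R[i])};
  innerE : forall x : H, inner x x = `|x| ^+ 2
}.

#[short(type="hilbertType")]
HB.structure Definition Hilbert (R : realType) :=
  {H of CompleteNormedModule R[i] H & CompleteNormedModule_isHilbert R H}.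

Section Operators.
Context {R : realType} {H : hilbertType R}.
Implicit Types (T A : H -> H) (x y : H).

Definition bounded_op T := exists M : R, forall x, `|T x| <= M%:C * `|x|.

(* [get] returns an arbitrary point when no such z exists; for bounded linear T
   it exists and is unique, see [adjointP] below. *)
Definition adjoint T y : H :=
  get [set z : H | forall x, inner (T x) y = inner x z].

(* On R[i], 0 <= z means that z is real and nonnegative. *)
Definition positive_op A :=
  [/\ bounded_op A, adjoint A = A & forall x, 0 <= inner (A x) x].

Definition in_LA A T :=
  bounded_op T /\ range (adjoint T \o A) `<=` range A.

Definition innerA A x y : R[i] := inner (A x) y.

Definition normA A x : R := Num.sqrt (complex.Re (innerA A x x)).

(* The norm of R[i] is R[i]-valued, hence the real part. Suprema are taken in R,
   where sup set0 = 0; the empty case is A = 0. *)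
Definition op_normA A T : R :=
  sup [set normA A (T x) / normA A x |
       x in [set x | closure (range A) x /\ x != 0]].

Definition num_radiusA A T : R :=
  sup [set complex.Re `|innerA A (T x) x| | x in [set x | normA A x = 1]].

End Operators.

Section Riesz.
Context {R : realType} {H : hilbertType R}.
Implicit Types (x y z u v : H) (r t : R).

Let re x y := complex.Re (inner x y).
Let n x := complex.Re `|x|.

Let nE x : `|x| = (n x)%:C.
Proof. by rewrite RRe_real// normr_real. Qed.

Let n_ge0 x : 0 <= n x.
Proof. by rewrite -lecR -nE normr_ge0. Qed.

Let reE x : re x x = n x ^+ 2.
Proof. by rewrite /re innerE nE -rmorphXn. Qed.

Let reD x y z : re (x + y) z = re x z + re y z.
Proof. by rewrite /re linearDl raddfD. Qed.

Let Re_mul t (z : R[i]) : complex.Re (t%:C * z) = t * complex.Re z.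
Proof. by case: z => a b /=; rewrite mul0r subr0. Qed.

Let reZ t x z : re (t%:C *: x) z = t * re x z.
Proof. by rewrite /re linearZl_LR /= Re_mul. Qed.

Let reC x y : re x y = re y x.
Proof.
rewrite /re (hermitian_subproof x y) /= expr0 mul1r.
by case: (inner y x).
Qed.

Let reDr x y z : re x (y + z) = re x y + re x z.
Proof. by rewrite !(reC x) reD. Qed.

Let reZr t x z : re x (t%:C *: z) = t * re x z.
Proof. by rewrite !(reC x) reZ. Qed.

Let CS x y : `|re x y| <= n x * n y.
Proof.
have key z : re x z <= n x * n z.
  have [nx0|nx0] := eqVneq (n x) 0.
    have -> : x = 0 by apply/eqP; rewrite -normr_eq0 nE nx0.
    by rewrite /re linear0l /n normr0 mul0r.
  have [nz0|nz0] := eqVneq (n z) 0.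
    have -> : z = 0 by apply/eqP; rewrite -normr_eq0 nE nz0.
    by rewrite reC /re linear0l /n normr0 mulr0.
  have xz0 : 0 < n x * n z by rewrite mulr_gt0// lt0r ?nx0 ?nz0 n_ge0.
  have := reE ((n z)%:C *: x + (- n x)%:C *: z).
  rewrite !(reD,reDr,reZ,reZr) (reC z x) !reE => e.
  have := sqr_ge0 (n ((n z)%:C *: x + (- n x)%:C *: z)); rewrite -{}e.
  rewrite (_ : _ + _ = 2 * (n x * n z) * (n x * n z - re x z)); last by ring.
  by rewrite pmulr_rge0 ?subr_ge0// mulr_gt0.
rewrite ler_norml key andbT lerNl.
have <- : re x ((-1)%:C *: y) = - re x y by rewrite reZr mulN1r.
apply: le_trans (key _) _; rewrite (_ : n ((-1)%:C *: y) = n y)//.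
by rewrite /n normrZ rmorphN1 normrN1 mul1r.
Qed.

Lemma adjointP (T : {linear H -> H}) : bounded_op T ->
  forall x y, inner (T x) y = inner x (adjoint T y).
Proof.
move=> [M TM] x y.
suff [z zP] : exists z, forall x, inner (T x) y = inner x z.
  by rewrite /adjoint; case: xgetP => [_ _ /(_ x)//|/(_ z)].
move=> {x}.
pose g x := re (T x) y.
have gD u v : g (u + v) = g u + g v by rewrite /g linearD reD.
have gZ t u : g (t%:C *: u) = t * g u by rewrite /g linearZ reZ.
pose C := `|M| * n y.
have C0 : 0 <= C by rewrite mulr_ge0.
have gC u : g u <= C * n u.
  have := TM u; rewrite !nE -rmorphM lecR => Tu.
  apply: le_trans (ler_norm _) _; apply: le_trans (CS _ _) _.
  rewrite /C mulrAC ler_wpM2r//; apply: le_trans Tu _.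
  by rewrite ler_wpM2r// ler_norm.
pose J u := n u ^+ 2 - 2 * g u.
have JC u : - C ^+ 2 <= J u.
  have := gC u; have := sqr_ge0 (n u - C); rewrite /J => h1 h2.
  have -> : n u ^+ 2 = (n u - C) ^+ 2 + 2 * (C * n u) - C ^+ 2 by ring.
  lra.
pose m := inf (range J).
have mJ u : m <= J u.
  by apply: ge_inf; [exists (- C ^+ 2) => _ [v _ <-] | exists u].
have hi : has_inf (range J).
  by split; [exists (J 0), 0 | exists (- C ^+ 2) => _ [v _ <-]].
have : forall k : nat, exists u, J u < m + k.+1%:R^-1.
  move=> k; have k0 : 0 < k.+1%:R^-1 :> R by rewrite invr_gt0.
  have [_ [u _ <-] h] := inf_adherent k0 hi.
  by exists u.
move=> /choice[u uP].
have JD a b t : J (a + t%:C *: b) =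
    J a + 2 * t * (re a b - g b) + t ^+ 2 * n b ^+ 2.
  rewrite /J gD gZ -!reE !(reD,reDr,reZ,reZr) (reC b a); ring.
have dist i j : n (u i - u j) ^+ 2 <= 2 * (i.+1%:R^-1 + j.+1%:R^-1).
  pose d := u j - u i.
  have -> : n (u i - u j) = n d by rewrite /n distrC.
  have e1 : J (u j) = J (u i) + 2 * 1 * (re (u i) d - g d) + 1 ^+ 2 * n d ^+ 2.
    by rewrite -JD scale1r addrC subrK.
  have := mJ (u i + (2^-1)%:C *: d).
  rewrite JD; have := uP i; have := uP j; rewrite e1.
  move: (re _ _ - g d) (n d ^+ 2) (J (u i)) (i.+1%:R^-1) (j.+1%:R^-1) => *; lra.
have ucvg : cvg (u @ \oo).
  apply: cauchy_cvg; apply: cauchy_exP => eps eps0.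
  have eE : eps = (complex.Re eps)%:C by rewrite RRe_real// gtr0_real.
  set r := complex.Re eps in eE.
  have r0 : 0 < r by rewrite -ltcR -eE.
  have r20 : 0 < r ^+ 2 / 4 by rewrite divr_gt0// exprn_gt0.
  have [N _ NP] := near_infty_natSinv_lt (PosNum r20).
  exists (u N); exists N => // k /= Nk.
  rewrite -ball_normE /= nE eE ltcR.
  have h := dist N k.
  have h1 : N.+1%:R^-1 < r ^+ 2 / 4 := NP N (leqnn _).
  have h2 : k.+1%:R^-1 < r ^+ 2 / 4 := NP k Nk.
  rewrite -(@ltr_pXn2r _ 2)// ?nnegrE ?n_ge0 ?(ltW r0)//.
  apply: le_lt_trans h _.
  by move: (N.+1%:R^-1) (k.+1%:R^-1) h1 h2 => *; lra.
pose z := lim (u @ \oo).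
have reg v : re z v = g v.
  apply/eqP; rewrite -subr_eq0 -normr_le0; apply/ler_addgt0Pl => e e0.
  rewrite addr0.
  pose b := n v + 1.
  have b0 : 0 < b by rewrite ltr_wpDl.
  have eb : 0 < e / (2 * b) by rewrite divr_gt0// mulr_gt0.
  have eb2 : 0 < (e / (2 * b)) ^+ 2 by rewrite exprn_gt0.
  have [N1 _ NP1] := near_infty_natSinv_lt (PosNum eb2).
  have eb' : 0 < (e / (2 * b))%:C by rewrite ltcR.
  have [N2 _ NP2] := @cvgr_dist_lt _ _ _ _ _ _ _ ucvg _ eb'.
  pose k := maxn N1 N2.
  have := NP2 k (leq_maxr _ _); rewrite /= nE ltcR => h2.
  have h1 : k.+1%:R^-1 < (e / (2 * b)) ^+ 2 := NP1 k (leq_maxl _ _).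
  pose d := re (u k) v - g v.
  have dE : `|d| <= e / (2 * b) * n v.
    have [v0|v0] := eqVneq (n v) 0.
      have v00 : v = 0 by apply/eqP; rewrite -normr_eq0 nE v0.
      rewrite /d /g v00 linear0 reC /re !linear0l subr0 normr0.
      by rewrite mulr_ge0// ltW.
    have vp : 0 < n v ^+ 2 by rewrite exprn_gt0// lt0r v0 n_ge0.
    rewrite -(@ler_pXn2r _ 2)// ?nnegrE ?(mulr_ge0 (ltW eb) (n_ge0 v))//.
    rewrite real_normK ?num_real// exprMn.
    have := mJ (u k + (- d / n v ^+ 2)%:C *: v); rewrite JD -/d.
    have -> : J (u k) + 2 * (- d / n v ^+ 2) * d + (- d / n v ^+ 2) ^+ 2 * n v ^+ 2
         = J (u k) - d ^+ 2 / n v ^+ 2 by field; rewrite v0.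
    move=> h; have := uP k => h'.
    have : d ^+ 2 / n v ^+ 2 <= (e / (2 * b)) ^+ 2.
      move: (k.+1%:R^-1) (_ ^+ 2 / _) ((e / _) ^+ 2) (J _) h h' h1 => *; lra.
    by rewrite ler_pdivrMr.
  have -> : re z v - g v = re (z - u k) v + d.
    rewrite /d reD.
    have -> : re (- u k) v = - re (u k) v by rewrite /re linearNl raddfN.
    by rewrite addrA subrK.
  apply: le_trans (ler_normD _ _) _.
  have h3 : `|re (z - u k) v| <= e / (2 * b) * n v.
    by apply: le_trans (CS _ _) _; rewrite ler_wpM2r// ltW.
  have : e / (2 * b) * n v <= e / 2.
    rewrite invfM mulrA -mulrA ler_piMr ?divr_ge0 ?ltW//.
    by rewrite mulrC ltr_pdivrMr// mul1r ltrDl.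
  lra.
exists z => v.
have e1 w : complex.Re (inner (T w) y) = complex.Re (inner w z).
  by rewrite -[LHS]/(g w) -reg [LHS]reC.
have := e1 ('i *: v); rewrite linearZ !linearZl_LR /=; move: (e1 v).
by case: (inner (T v) y) (inner v z) => a b [c d] /= ->; rewrite !mul0r !mul1r !sub0r => /oppr_inj ->.
Qed.

End Riesz.

(* Main.v *)
(* Write <x, y>_A for the semi-inner product given by A. An operator T in L_A
   has an A-adjoint map S with A S = T^* A, and S T is A-selfadjoint. For an
   A-selfadjoint G, Cauchy-Schwarz shows that the growth rate of the moments
   <G^n x, x>_A bounds |<G x, x>_A| / <x, x>_A. Used with G = S T this makes T
   bounded for the A-seminorm, so that the suprema are finite; since the range
   of A is dense for the A-seminorm, |T x|_A <= |T|_A |x|_A for every x. After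
   rotating T1 by a phase, |<T1 T2 x, x>_A| is half of <G x, x>_A for
   G = T1 T2 + S2 S1. This G is the row (T1, S2) composed with the column
   (T2, S1); the composite in the other order has entries T2 T1, T2 S2, S1 T1,
   S1 S2, and its growth rate is at most |T2 T1|_A + |T1|_A |T2|_A. *)
Require Import Defs.
From mathcomp Require Import all_boot all_order all_algebra.
From mathcomp Require Import complex.
From mathcomp Require Import all_classical all_reals all_analysis.
From mathcomp Require Import ring lra.

Set Implicit Arguments.
Unset Strict Implicit.

Import Order.TTheory GRing.Theory Num.Theory.
Import numFieldNormedType.Exports.
Local Open Scope classical_set_scope.
Local Open Scope ring_scope.

Lemma geometric_lt (R : realType) (C q e : R) : 0 <= q < 1 -> 0 < e ->
  exists N, forall n, (N <= n)%N -> C * q ^+ n < e.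
Proof.
move=> /andP[q0 q1] e0.
have q1' : `|q| < 1 by rewrite ger0_norm.
have d0 : 0 < e / (`|C| + 1) by rewrite divr_gt0// ltr_wpDl.
have [N _ NP] := @cvgr_dist_lt _ _ _ _ _ _ _ (cvg_expr q1') _ d0.
exists N => n /NP /=; rewrite sub0r normrN ger0_norm ?exprn_ge0// => h.
apply: (@le_lt_trans _ _ (`|C| * q ^+ n)).
  by rewrite ler_wpM2r ?exprn_ge0// ler_norm.
apply: (@le_lt_trans _ _ ((`|C| + 1) * q ^+ n)).
  by rewrite ler_wpM2r ?exprn_ge0// lerDl.
by rewrite mulrC -ltr_pdivlMr// ltr_wpDl.
Qed.

(** * Real semi-inner products, adjoint pairs and growth of moments *)

Section SemiInnerProduct.
Context {R : realType} {V : lmodType R[i]}.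

(** Real-valued and real-linear on a complex space: the forms in view are the real parts of [inner]
    and [innerA]. *)
Definition semi_inner (B : V -> V -> R) :=
  [/\ forall x y, B x y = B y x,
      forall x y z, B (x + y) z = B x z + B y z,
      forall t x y, B (t%:C%C *: x) y = t * B x y &
      forall x, 0 <= B x x].

(** [T] and [S] are bare maps, since an A-adjoint chosen pointwise is fixed only modulo the kernel
    of A. *)
Definition adj_pair (B : V -> V -> R) (T S : V -> V) :=
  forall x y, B (T x) y = B x (S y).

Context {B : V -> V -> R} (hB : semi_inner B).
Implicit Types (x y z u v : V) (S T : V -> V).

Local Notation p x := (Num.sqrt (B x x)).

Let BC x y : B x y = B y x. Proof. by case: hB. Qed.
Let BD x y z : B (x + y) z = B x z + B y z. Proof. by case: hB. Qed.
Let BZ t x y : B (t%:C%C *: x) y = t * B x y. Proof. by case: hB. Qed.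
Let B_ge0 x : 0 <= B x x. Proof. by case: hB. Qed.
Let BDr x y z : B x (y + z) = B x y + B x z. Proof. by rewrite !(BC x) BD. Qed.
Let BZr t x y : B x (t%:C%C *: y) = t * B x y.
Proof. by rewrite !(BC x) BZ. Qed.
Let pE x : p x ^+ 2 = B x x. Proof. by rewrite sqr_sqrtr. Qed.

Lemma semi_inner_CS_sqr x y : B x y ^+ 2 <= B x x * B y y.
Proof.
have key t : 0 <= B x x + 2 * t * B x y + t ^+ 2 * B y y.
  have := B_ge0 (x + t%:C%C *: y); rewrite !(BD, BDr, BZ, BZr) (BC y x).
  by move=> h; apply: le_trans h _; rewrite le_eqVlt; apply/orP; left;
     apply/eqP; ring.
have [y0|y0] := eqVneq (B y y) 0.
  have [->|xy0] := eqVneq (B x y) 0; first by rewrite expr0n mulr_ge0.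
  (* The quadratic in t is now affine with nonzero slope; this t gives it the value -1. *)
  have := key (- (B x x + 1) / (2 * B x y)).
  rewrite y0 mulr0 addr0.
  have -> : B x x + 2 * (- (B x x + 1) / (2 * B x y)) * B x y = - 1.
    by field.
  by rewrite lerNr oppr0 ler10.
have yp : 0 < B y y by rewrite lt0r y0 B_ge0.
have := key (- B x y / B y y).
have -> : B x x + 2 * (- B x y / B y y) * B x y + (- B x y / B y y) ^+ 2 * B y y
    = (B x x * B y y - B x y ^+ 2) / B y y by field.
by rewrite pmulr_lge0 ?invr_gt0// subr_ge0.
Qed.

Lemma semi_inner_CS x y : `|B x y| <= p x * p y.
Proof.
by rewrite -sqrtrM// -sqrtr_sqr ler_sqrt ?mulr_ge0// semi_inner_CS_sqr.
Qed.

Lemma semi_norm_le x c : 0 <= c -> B x x <= c * p x -> p x <= c.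
Proof.
move=> c0; rewrite -[leLHS]pE; have [->//|x0] := eqVneq (p x) 0.
by rewrite expr2 ler_pM2r// lt0r x0 sqrtr_ge0.
Qed.

Lemma semi_normD x y : p (x + y) <= p x + p y.
Proof.
apply: semi_norm_le; first by rewrite addr_ge0 ?sqrtr_ge0.
rewrite [leLHS]BD mulrDl lerD//; apply: le_trans (ler_norm _) _;
  exact: semi_inner_CS.
Qed.

Lemma adj_pairC T S : adj_pair B T S -> adj_pair B S T.
Proof. by move=> TS x y; rewrite BC -TS BC. Qed.

(** Cauchy-Schwarz in p(S x)^2 = B (T (S x)) x <= c p(S x) p(x), then division by p(S x). *)
Lemma adj_pair_le T S c : adj_pair B T S -> 0 <= c ->
  (forall x, p (T x) <= c * p x) -> forall x, p (S x) <= c * p x.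
Proof.
move=> TS c0 Tc x; apply: semi_norm_le; first by rewrite mulr_ge0 ?sqrtr_ge0.
rewrite -[leLHS]TS; apply: le_trans (ler_norm _) _.
apply: le_trans (semi_inner_CS _ _) _.
by rewrite mulrAC ler_wpM2r ?sqrtr_ge0.
Qed.

(* Only B determines S: S need not be additive. *)
Lemma adj_pair_subadd T S : adj_pair B T S -> forall x y,
  p (S (x + y)) <= p (S x) + p (S y).
Proof.
move=> TS x y; apply: semi_norm_le; first by rewrite addr_ge0 ?sqrtr_ge0.
rewrite -[leLHS]TS [leLHS]BDr !(TS (S (x + y))) mulrDl.
rewrite ![_ * p (S (_ + _))]mulrC.
by rewrite lerD//; apply: le_trans (ler_norm _) _; exact: semi_inner_CS.
Qed.

(* The moments a_n = B (G^n x) x satisfy a_n^2 <= a_0 a_(2n), so that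
   (|a_1| / a_0)^(2^k) <= a_(2^k) / a_0: a bound on the growth rate of the
   moments is a bound on |a_1| / a_0. *)
Lemma self_adj_moment G x (c L : R) : adj_pair B G G -> 0 <= L ->
  (forall n, `|B (iter n.+1 G x) x| <= c * L ^+ n) -> `|B (G x) x| <= L * B x x.
Proof.
move=> GG L0 Gc.
pose a n := B (iter n G x) x.
have aD m n : B (iter m G x) (iter n G x) = a (m + n)%N.
  elim: n m => [|n IH] m; first by rewrite addn0.
  by rewrite iterS -GG -iterS IH addSnnS.
have a2 n : `|a n| ^+ 2 <= a 0%N * a (n + n)%N.
  rewrite real_normK ?num_real// -aD /a /= [leRHS]mulrC.
  exact: semi_inner_CS_sqr.
have [a0|a0] := eqVneq (B x x) 0.
  have := a2 1%N; rewrite /a /= a0 mul0r mulr0.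
  rewrite real_normK ?num_real// => h.
  by rewrite normr_le0 -sqrf_eq0 eq_le h sqr_ge0.
have a0p : 0 < a 0%N by rewrite lt0r B_ge0 andbT.
pose b n := `|a n| / a 0%N.
have b_ge0 n : 0 <= b n by rewrite divr_ge0// ltW.
have bn k : b 1%N ^+ (2 ^ k) <= b (2 ^ k)%N.
  elim: k => // k IH; rewrite [in leLHS]expnSr exprM.
  apply: (@le_trans _ _ (b (2 ^ k)%N ^+ 2)).
    by rewrite lerXn2r ?nnegrE ?exprn_ge0.
  have -> : b (2 ^ k)%N ^+ 2 = `|a (2 ^ k)%N| ^+ 2 / a 0%N / a 0%N.
    by rewrite /b expr_div_n [in X in _ / X]expr2 invfM mulrA.
  rewrite ler_pM2r ?invr_gt0// ler_pdivrMr// expnSr muln2 -addnn mulrC.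
  by apply: le_trans (a2 _) _; rewrite ler_pM2l// ler_norm.
rewrite -ler_pdivrMr//; change (b 1%N <= L); rewrite leNgt; apply/negP => Lb.
have bp : 0 < b 1%N by apply: le_lt_trans Lb.
have q01 : 0 <= L / b 1%N < 1.
  by rewrite divr_ge0//= ltr_pdivrMr// mul1r.
(* With n + 1 = 2^N, [Gc] and [bn] give b_1^(n+1) <= (c / a_0) L^n, while L < b_1 forces (c / a_0)
   (L / b_1)^n < b_1 for large N. *)
have [N /(_ (2 ^ N).-1)] := geometric_lt (c / a 0%N) q01 bp.
have N2 : (2 ^ N).-1.+1 = (2 ^ N)%N by rewrite prednK// expn_gt0.
have /[swap]/[apply] : (N <= (2 ^ N).-1)%N by rewrite -ltnS N2 ltn_expl.
have := bn N; have := Gc (2 ^ N).-1; rewrite -N2.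
move: (2 ^ N).-1 => n; rewrite -/(a n.+1) exprS => h1 h2.
rewrite expr_div_n mulrA ltr_pdivrMr ?exprn_gt0// ltNge => /negP; apply.
apply: le_trans h2 _; rewrite /b mulrAC ler_pM2r ?invr_gt0//.
Qed.

(* The self-adjoint operator G = T1 T2 + S2 S1 factors through the pair of maps
   (T2, S1), and a1 p(T2 -) + a2 p(S1 -) grows at most by the factor b + a1 a2
   under G. *)
Lemma adj_pair_product T1 S1 T2 S2 a1 a2 b x :
  adj_pair B T1 S1 -> adj_pair B T2 S2 -> 0 <= a1 -> 0 <= a2 -> 0 <= b ->
  (forall x, p (T1 x) <= a1 * p x) -> (forall x, p (T2 x) <= a2 * p x) ->
  (forall x, p (T2 (T1 x)) <= b * p x) ->
  2 * B (T1 (T2 x)) x <= (b + a1 * a2) * B x x.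
Proof.
move=> TS1 TS2 a10 a20 b0 T1a T2a Tb.
have S1a := adj_pair_le TS1 a10 T1a; have S2a := adj_pair_le TS2 a20 T2a.
have TS21 : adj_pair B (T2 \o T1) (S1 \o S2) by move=> u v /=; rewrite TS2 TS1.
have Sb := adj_pair_le TS21 b0 Tb.
pose G u := T1 (T2 u) + S2 (S1 u).
have GG : adj_pair B G G.
  move=> u v; rewrite /G BD BDr TS1 TS2 addrC.
  by rewrite (adj_pairC TS2) (adj_pairC TS1).
(* The entries T2 T1, T2 S2, S1 T1, S1 S2 are bounded by b, a2^2, a1^2, b; the weights (a1, a2) are
   a left eigenvector of this matrix of bounds, with eigenvalue b + a1 a2. *)
pose s u := a1 * p (T2 u) + a2 * p (S1 u).
have sG u : s (G u) <= (b + a1 * a2) * s u.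
  have h1 : p (T2 (G u)) <= b * p (T2 u) + a2 * (a2 * p (S1 u)).
    apply: le_trans (adj_pair_subadd (adj_pairC TS2) _ _) _.
    by apply: lerD (Tb _) _; apply: le_trans (T2a _) _; rewrite ler_wpM2l.
  have h2 : p (S1 (G u)) <= a1 * (a1 * p (T2 u)) + b * p (S1 u).
    apply: le_trans (adj_pair_subadd TS1 _ _) _.
    by apply: lerD _ (Sb _); apply: le_trans (S1a _) _; rewrite ler_wpM2l.
  have := lerD (ler_wpM2l a10 h1) (ler_wpM2l a20 h2).
  move=> /le_trans; apply; rewrite /s.
  by rewrite le_eqVlt; apply/orP; left; apply/eqP; ring.
have pG u : p (G u) <= s u.
  by apply: le_trans (semi_normD _ _) (lerD (T1a _) (S2a _)).
have L0 : 0 <= b + a1 * a2 by rewrite addr_ge0 ?mulr_ge0.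
have sn n : s (iter n G x) <= s x * (b + a1 * a2) ^+ n.
  elim: n => [|n IH]; first by rewrite mulr1.
  rewrite iterS exprS; apply: le_trans (sG _) _.
  by rewrite mulrCA ler_wpM2l.
have := @self_adj_moment G x (s x * p x) _ GG L0.
(* The two summands of [G] are adjoint to each other, so they contribute equally. *)
have -> : B (G x) x = 2 * B (T1 (T2 x)) x.
  by rewrite /G BD (adj_pairC TS2) (adj_pairC TS1) (BC x); ring.
move=> h; apply: le_trans (ler_norm _) (h _) => n.
apply: le_trans (semi_inner_CS _ _) _.
rewrite mulrAC ler_wpM2r ?sqrtr_ge0//.
exact: le_trans (pG _) (sn n).
Qed.

End SemiInnerProduct.

(** * Completeness and uniform boundedness in the Hilbert norm *)

Section HilbertSpace.
Context {R : realType} {H : hilbertType R}.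
Implicit Types (x y z u v : H) (S T : H -> H).

Definition re_inner x y : R := complex.Re (inner x y).

Definition rnorm x : R := complex.Re `|x|.

Lemma rnormE x : `|x| = (rnorm x)%:C%C.
Proof. by rewrite RRe_real// normr_real. Qed.

Lemma rnorm_ge0 x : 0 <= rnorm x.
Proof. by rewrite -lecR -rnormE normr_ge0. Qed.

Lemma re_inner_sqr x : re_inner x x = rnorm x ^+ 2.
Proof. by rewrite /re_inner innerE rnormE -rmorphXn. Qed.

Lemma re_inner_semi : semi_inner re_inner.
Proof.
split=> [x y|x y z|t x y|x].
- rewrite /re_inner (hermitian_subproof x y) /= expr0 mul1r.
  by case: (inner y x).
- by rewrite /re_inner linearDl raddfD.
- rewrite /re_inner linearZl_LR /=; case: (inner x y) => a b /=.
  by rewrite mul0r subr0.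
- by rewrite re_inner_sqr sqr_ge0.
Qed.

Lemma rnormS x : rnorm x = Num.sqrt (re_inner x x).
Proof. by rewrite re_inner_sqr sqrtr_sqr ger0_norm// rnorm_ge0. Qed.

Lemma rnormZ (t : R) x : rnorm (t%:C%C *: x) = `|t| * rnorm x.
Proof.
by rewrite /rnorm normrZ normc_def /= expr0n addr0 sqrtr_sqr rnormE -rmorphM.
Qed.

Lemma rnorm0 : rnorm 0 = 0.
Proof. by rewrite /rnorm normr0. Qed.

Lemma rnormN x : rnorm (- x) = rnorm x.
Proof. by rewrite /rnorm normrN. Qed.

Lemma rnormD x y : rnorm (x + y) <= rnorm x + rnorm y.
Proof. by rewrite -lecR rmorphD /= -!rnormE ler_normD. Qed.

Lemma re_inner_le x y : `|re_inner x y| <= rnorm x * rnorm y.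
Proof. by rewrite !rnormS; exact: semi_inner_CS re_inner_semi _ _. Qed.

(** Completeness with an error estimate: for fixed n, the Cauchy bound passes to the limit in m. *)
Lemma cvg_rnorm_bound (u : nat -> H) (e : nat -> R) :
  (forall n m, (n <= m)%N -> rnorm (u n - u m) <= e n) ->
  (forall d, 0 < d -> exists n, e n < d) ->
  exists l, forall n, rnorm (u n - l) <= e n.
Proof.
move=> ue e0.
have ucvg : cvg (u @ \oo).
  apply: cauchy_cvg; apply: cauchy_exP => eps eps0.
  have eE : eps = (complex.Re eps)%:C%C by rewrite RRe_real// gtr0_real.
  have /e0[N eN] : 0 < complex.Re eps by rewrite -ltcR -eE.
  exists (u N); exists N => // k /= Nk.
  rewrite -ball_normE /= rnormE eE ltcR.
  exact: le_lt_trans (ue _ _ Nk) eN.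
exists (lim (u @ \oo)) => n; apply/ler_addgt0Pl => d d0.
have dC : 0 < d%:C%C by rewrite ltcR.
have [N _ NP] := @cvgr_dist_lt _ _ _ _ _ _ _ ucvg _ dC.
have := NP (maxn n N) (leq_maxr _ _); rewrite /= rnormE ltcR => h.
have -> : u n - lim (u @ \oo) =
    - (lim (u @ \oo) - u (maxn n N)) + (u n - u (maxn n N)).
  by rewrite opprB [RHS]addrC addrA subrK.
apply: le_trans (rnormD _ _) _; rewrite rnormN.
by apply: lerD (ltW h) (ue _ _ (leq_maxl _ _)).
Qed.

(* If rnorm (f i) is never bounded by a multiple of c i, choose i_k with
   rnorm (f i_k) > 2 k 3^k c(i_k) and move at step k by 3^-k in the direction of
   +-f i_k, the sign being such that the inner product with f i_k does not
   decrease in modulus. The later steps have total length at most 3^-k / 2, so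
   the limit has inner product at least k c(i_k) with f i_k. *)
Lemma uniform_boundedness (I : Type) (f : I -> H) (c : I -> R) :
  (forall i, 0 <= c i) ->
  (forall v, exists M, forall i, `|re_inner v (f i)| <= M * c i) ->
  exists K, forall i, rnorm (f i) <= K * c i.
Proof.
move=> c0 fM; apply: contrapT => /forallNP nK.
have [_ ID IZ _] := re_inner_semi.
have ik k : exists i, 2 * 3 ^+ k * k%:R * c i < rnorm (f i).
  have /existsNP[i /negP] := nK (2 * 3 ^+ k * k%:R).
  by rewrite -ltNge; exists i.
have [i iP] := choice ik.
pose g k := f (i k).
have g0 k : 0 < rnorm (g k).
  by apply: le_lt_trans (iP k); rewrite !mulr_ge0 ?exprn_ge0.
pose r k : R := 3^-1 ^+ k.
have r0 k : 0 < r k by rewrite exprn_gt0// invr_gt0.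
pose sg v k : R := if 0 <= re_inner v (g k) then 1 else -1.
have sg1 v k : `|sg v k| = 1 by rewrite /sg; case: ifP; rewrite ?normrN normr1.
pose step v k := (sg v k * (r k / rnorm (g k)))%:C%C *: g k.
pose fix u k : H := if k is k'.+1 then u k' + step (u k') k' else 0.
have uS k : rnorm (u k - u k.+1) = r k.
  rewrite /= opprD addNKr rnormN rnormZ normrM sg1 mul1r.
  by rewrite ger0_norm ?divr_ge0 ?(ltW (r0 _)) ?rnorm_ge0// divfK// gt_eqF.
have rS k : r k.+1 = r k / 3 by rewrite /r exprSr.
have ue n m : (n <= m)%N -> rnorm (u n - u m) <= 3 / 2 * r n.
  (* Keeping the exact partial geometric sum lets the induction on m close, as r_m = 3/2 (r_m -
     r_(m+1)). *)
  move=> nm; suff : rnorm (u n - u m) <= 3 / 2 * (r n - r m).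
    by have := r0 m; lra.
  elim: m nm => [|m IH].
    by rewrite leqn0 => /eqP ->; rewrite !subrr mulr0 rnorm0.
  rewrite leq_eqVlt => /predU1P[->|/IH]; first by rewrite !subrr mulr0 rnorm0.
  have := rnormD (u n - u m) (u m - u m.+1); rewrite uS addrA subrK rS.
  move: (rnorm _) (rnorm _) => *; lra.
have [|l lP] := cvg_rnorm_bound ue.
  move=> d d0; have q01 : 0 <= (3^-1 : R) < 1 by apply/andP; split; lra.
  by have [N NP] := geometric_lt (3 / 2) q01 d0; exists N; exact: NP.
have us k : r k * rnorm (g k) <= `|re_inner (u k.+1) (g k)|.
  rewrite /= ID IZ re_inner_sqr.
  have -> : sg (u k) k * (r k / rnorm (g k)) * rnorm (g k) ^+ 2 =
      sg (u k) k * (r k * rnorm (g k)).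
    by move: (rnorm _) (g0 k) => m m0; field; rewrite gt_eqF.
  have := mulr_gt0 (r0 k) (g0 k); rewrite /sg; case: ifP => [h1 h2|/negbT].
    by rewrite mul1r ger0_norm; lra.
  by rewrite -ltNge => h1 h2; rewrite mulN1r ltr0_norm; lra.
have lg k : r k / 2 * rnorm (g k) <= `|re_inner l (g k)|.
  have : re_inner (u k.+1) (g k) =
      re_inner (u k.+1 - l) (g k) + re_inner l (g k).
    by rewrite -ID subrK.
  have := re_inner_le (u k.+1 - l) (g k).
  have := ler_wpM2r (rnorm_ge0 (g k)) (lP k.+1); rewrite rS.
  have := us k => h1 h2 h3 h4.
  have := ler_normD (re_inner (u k.+1 - l) (g k)) (re_inner l (g k)).
  rewrite -h4; move: h1 h2 h3; nra.
have [M MP] := fM l.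
have [k Mk] : exists k : nat, M <= k%:R.
  exists (Num.truncn `|M|).+1.
  exact: le_trans (ler_norm _) (ltW (truncnS_gt _)).
have := le_trans (lg k) (MP (i k)); apply/negP; rewrite -ltNge.
apply: le_lt_trans (ler_wpM2r (c0 _) Mk) _.
have -> : k%:R * c (i k) = r k / 2 * (2 * 3 ^+ k * k%:R * c (i k)).
  rewrite /r exprVn; field; exact: expf_neq0.
by rewrite ltr_pM2l// divr_gt0.
Qed.

End HilbertSpace.

(** * Bounds on operators and their adjoints *)

Section BoundedOperators.
Context {R : realType} {H : hilbertType R}.
Implicit Types (x y : H).

Lemma bounded_rnorm (T : H -> H) : bounded_op T ->
  exists2 M : R, 0 < M & forall x, rnorm (T x) <= M * rnorm x.
Proof.
move=> [M TM]; exists (`|M| + 1) => [|x]; first by rewrite ltr_wpDl.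
have := TM x; rewrite !rnormE -rmorphM lecR => /le_trans; apply.
by rewrite ler_wpM2r ?rnorm_ge0// ler_wpDr// ler_norm.
Qed.

Lemma adj_pair_adjoint (T : {linear H -> H}) : bounded_op T ->
  adj_pair (@re_inner R H) T (adjoint T).
Proof. by move=> Tb x y; rewrite /re_inner adjointP. Qed.

Lemma rnorm_adjoint (T : {linear H -> H}) M : bounded_op T -> 0 <= M ->
  (forall x, rnorm (T x) <= M * rnorm x) ->
  forall x, rnorm (adjoint T x) <= M * rnorm x.
Proof.
move=> Tb M0 TM x; rewrite !rnormS.
apply: (adj_pair_le re_inner_semi (adj_pair_adjoint Tb) M0) => y.
by rewrite -!rnormS.
Qed.

Lemma op_normA_ge0 (A T : H -> H) : 0 <= op_normA A T.
Proof.
rewrite /op_normA; set E := [set _ | _ in _].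
(* By convention [sup] is 0 on an empty or unbounded set. *)
have [[[r Er] ubE]|/sup_out ->//] := pselect (has_sup E).
apply: le_trans (ub_le_sup ubE Er).
by case: Er => x _ <-; rewrite divr_ge0 ?sqrtr_ge0.
Qed.

End BoundedOperators.

(** * The seminorm of a positive operator and A-adjoints *)

Section PositiveOperator.
Context {R : realType} {H : hilbertType R} {A : {linear H -> H}}.
Context (hA : positive_op A).
Implicit Types (x y z : H).

Definition formA x y : R := complex.Re (innerA A x y).

Let Ab : bounded_op A. Proof. by case: hA. Qed.

Lemma positive_op_sym x y : inner (A x) y = inner x (A y).
Proof. by case: hA => _ AA _; rewrite adjointP// AA. Qed.

Lemma formA_semi : semi_inner formA.
Proof.
have [IC ID IZ I0] := @re_inner_semi R H.
split=> [x y|x y z|t x y|x].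
- by rewrite /formA /innerA positive_op_sym; exact: IC.
- by rewrite /formA /innerA linearD; exact: ID.
- by rewrite /formA /innerA linearZ; exact: IZ.
- by case: hA => _ _ /(_ x); rewrite lecE => /andP[].
Qed.

Lemma formA_sqr x : formA x x = normA A x ^+ 2.
Proof. by have [_ _ _ F0] := formA_semi; rewrite sqr_sqrtr//; exact: F0. Qed.

(** Cauchy-Schwarz for [formA] at x and A x: |A x|^4 <= <x, x>_A <A x, A x>_A, whose last factor is
    at most M |A x|^2. *)
Lemma positive_op_sqr_le M : 0 <= M ->
  (forall x, rnorm (A x) <= M * rnorm x) ->
  forall x, rnorm (A x) ^+ 2 <= M * formA x x.
Proof.
move=> M0 AM x.
have := semi_inner_CS_sqr formA_semi x (A x).
have -> : formA x (A x) = rnorm (A x) ^+ 2 by exact: re_inner_sqr.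
have AA : formA (A x) (A x) <= M * rnorm (A x) ^+ 2.
  apply: le_trans (ler_norm _) _; apply: le_trans (re_inner_le _ _) _.
  by rewrite expr2 mulrA ler_wpM2r ?rnorm_ge0.
have [_ _ _ /(_ x) xx] := formA_semi.
have [->|n0] := eqVneq (rnorm (A x) ^+ 2) 0; first by rewrite mulr_ge0.
have np : 0 < rnorm (A x) ^+ 2 by rewrite lt0r n0 sqr_ge0.
move=> /le_trans/(_ (ler_wpM2l xx AA)).
by rewrite [leLHS]expr2 [leRHS]mulrA ler_pM2r// mulrC.
Qed.

(* The remainders w_(n+1) = w_n - t A w_n of Richardson's iteration satisfy
   |w_(n+1)|^2 <= |w_n|^2 - t |w_n|_A^2 for t = 1/M, so that |w_n|_A cannot stay
   bounded away from 0; and x - w_n is in the range of A. *)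
Lemma range_normA_dense x e : 0 < e -> exists y, normA A (x - A y) < e.
Proof.
move=> e0; have [M M0 AM] := bounded_rnorm Ab.
have AM2 := positive_op_sqr_le (ltW M0) AM.
have [IC ID IZ _] := @re_inner_semi R H.
pose w := fix w n := if n is n'.+1 then w n' + (- M^-1)%:C%C *: A (w n') else x.
have wE n : w n.+1 = w n + (- M^-1)%:C%C *: A (w n) by [].
have wS n : rnorm (w n.+1) ^+ 2 <= rnorm (w n) ^+ 2 - M^-1 * formA (w n) (w n).
  have IDr y z v : re_inner y (z + v) = re_inner y z + re_inner y v.
    by rewrite !(IC y) ID.
  have IZr t y z : re_inner y (t%:C%C *: z) = t * re_inner y z.
    by rewrite !(IC y) IZ.
  rewrite -!re_inner_sqr wE !(ID, IDr, IZ, IZr) (IC (w n) (A _)).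
  change (re_inner (A (w n)) (w n)) with (formA (w n) (w n)).
  rewrite (re_inner_sqr (A (w n))).
  have iM : 0 < M^-1 by rewrite invr_gt0.
  (* The quadratic term M^-2 |A w_n|^2 cancels at most half of the linear term -2 M^-1 |w_n|_A^2. *)
  have := ler_wpM2l (ltW iM) (AM2 (w n)); rewrite mulKf ?gt_eqF//.
  move=> /(ler_wpM2l (ltW iM)).
  by move: (formA _ _) (rnorm _ ^+ 2) (M^-1) => *; lra.
have wA n : exists y, x - A y = w n.
  elim: n => [|n [y yP]]; first by exists 0; rewrite linear0 subr0.
  exists (y + (M^-1)%:C%C *: w n).
  by rewrite wE linearD linearZ /= rmorphN scaleNr opprD addrA yP.
apply: contrapT => /forallNP ne.
have we n : e ^+ 2 <= formA (w n) (w n).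
  have [y <-] := wA n; rewrite formA_sqr lerXn2r ?nnegrE ?sqrtr_ge0 ?(ltW e0)//.
  by rewrite leNgt; apply/negP.
have d0 : 0 < M^-1 * e ^+ 2 by rewrite mulr_gt0 ?invr_gt0// exprn_gt0.
have wn n : rnorm (w n) ^+ 2 <= rnorm x ^+ 2 - n%:R * (M^-1 * e ^+ 2).
  elim: n => [|n IH]; first by rewrite mul0r subr0.
  have iM : 0 <= M^-1 by rewrite invr_ge0 ltW.
  have := ler_wpM2l iM (we n); have := wS n; move: IH; rewrite -natr1 mulrDl.
  by lra.
have := wn (Num.truncn (rnorm x ^+ 2 / (M^-1 * e ^+ 2))).+1.
apply/negP; rewrite -ltNge (lt_le_trans _ (sqr_ge0 _))// subr_lt0.
by rewrite -ltr_pdivrMr// truncnS_gt.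
Qed.

Lemma in_LA_adj (T : {linear H -> H}) : in_LA A T ->
  exists S, (forall y, A (S y) = adjoint T (A y)) /\
    forall x y, innerA A (T x) y = innerA A x (S y).
Proof.
move=> [Tb TA].
have /choice[S SP] : forall y, exists z, A z = adjoint T (A y).
  by move=> y; have [|z _ zP] := TA (adjoint T (A y)); [exists y | exists z].
exists S; split=> // x y.
by rewrite /innerA !positive_op_sym adjointP// SP.
Qed.

(* With A S = T^* A, [uniform_boundedness] gives |A T x| <= K |A x|; hence
   |A (S T)^n x| grows at most geometrically, and so do the moments of the
   A-selfadjoint map S T, for which <S T x, x>_A = |T x|_A^2. *)
Lemma in_LA_bounded (T : {linear H -> H}) : in_LA A T ->
  exists C : R, forall x, normA A (T x) <= C * normA A x.
Proof.
move=> TA; have [S [ASE TS]] := in_LA_adj TA.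
have [Tb _] := TA; have [M M0 TM] := bounded_rnorm Tb.
have [IC _ _ _] := @re_inner_semi R H.
have [K KP] : exists K : R, forall x, rnorm (A (T x)) <= K * rnorm (A x).
  (* The family is x -> A T x with weights |A x|; for fixed v the pointwise constant is |S v|. *)
  apply: uniform_boundedness => [x|v]; first exact: rnorm_ge0.
  exists (rnorm (S v)) => x; rewrite IC [leRHS]mulrC.
  have -> : re_inner (A (T x)) v = re_inner (A x) (S v).
    by have := TS x v; rewrite /re_inner /innerA => ->.
  exact: re_inner_le.
pose L := M * `|K|; have L0 : 0 <= L by rewrite mulr_ge0 ?(ltW M0).
have TSf : adj_pair formA T S by move=> x y; rewrite /formA TS.
pose G x := S (T x).
have GG : adj_pair formA G G.
  by move=> x y; rewrite /G (adj_pairC formA_semi TSf) TSf.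
have GL n x : rnorm (A (iter n G x)) <= L ^+ n * rnorm (A x).
  elim: n => [|n IH]; first by rewrite mul1r.
  rewrite iterS ASE exprS -mulrA.
  apply: le_trans (rnorm_adjoint Tb (ltW M0) TM _) _.
  rewrite {1}/L -mulrA ler_wpM2l ?(ltW M0)//; apply: le_trans (KP _) _.
  apply: le_trans (ler_wpM2r (rnorm_ge0 _) (ler_norm K)) _.
  by rewrite ler_wpM2l.
exists (Num.sqrt L) => x; rewrite -sqrtrM//.
have -> : complex.Re (innerA A x x) = formA x x by [].
rewrite ler_sqrt; last by rewrite mulr_ge0//; case: formA_semi.
change (formA (T x) (T x) <= L * formA x x).
rewrite TSf; have [FC _ _ _] := formA_semi; rewrite FC.
apply: le_trans (ler_norm _) _.
(* The extra factor L in c absorbs the shift: the moment of order n + 1 is compared with L^n. *)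
apply: (self_adj_moment formA_semi GG L0 (c := L * rnorm (A x) * rnorm x)) => n.
apply: le_trans (re_inner_le _ _) _.
rewrite [leRHS]mulrAC ler_wpM2r ?rnorm_ge0//.
by apply: le_trans (GL _ _) _; rewrite exprS [leLHS]mulrAC.
Qed.

(** A finite [C] makes the supremum a genuine bound on the range of A, and controls T on the
    remainder x - A y when density extends the bound to all x. *)
Lemma op_normA_le (T : {linear H -> H}) (C : R) :
  (forall x, normA A (T x) <= C * normA A x) ->
  forall x, normA A (T x) <= op_normA A T * normA A x.
Proof.
move=> TC x.
have N0 := op_normA_ge0 A T.
have nD y z : normA A (y + z) <= normA A y + normA A z.
  exact: semi_normD formA_semi _ _.
have rA y : normA A (T (A y)) <= op_normA A T * normA A (A y).
  have [Ay0|Ay0] := eqVneq (normA A (A y)) 0.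
    by rewrite Ay0 mulr0; apply: le_trans (TC _) _; rewrite Ay0 mulr0.
  have Ayp : 0 < normA A (A y) by rewrite lt0r Ay0 sqrtr_ge0.
  rewrite -ler_pdivrMr//; apply: ub_le_sup.
    exists `|C| => _ [z _ <-].
    (* A quotient with zero denominator is 0 by convention. *)
    have [->|z0] := eqVneq (normA A z) 0; first by rewrite invr0 mulr0.
    apply: le_trans (ler_norm C); rewrite ler_pdivrMr//.
    by rewrite lt0r z0 sqrtr_ge0.
  exists (A y) => //; split; first by apply: subset_closure; exists y.
  by apply: contra_neq Ay0 => ->; rewrite /normA /innerA linear0 sqrtr0.
apply/ler_addgt0Pl => e e0.
pose d := e / (op_normA A T + `|C| + 1).
have D0 : 0 < op_normA A T + `|C| + 1 by rewrite ltr_wpDl// addr_ge0.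
have d0 : 0 < d by rewrite divr_gt0.
have [y yd] := range_normA_dense x d0.
have h1 : normA A (T x) <= normA A (T (A y)) + normA A (T (x - A y)).
  by apply: le_trans (nD _ _); rewrite -linearD addrC subrK.
have h2 : normA A (A y) <= normA A x + normA A (x - A y).
  have -> : normA A (x - A y) = normA A (A y - x).
    by rewrite -opprB /normA /innerA linearN /= [A _]linearN linearNl opprK.
  by apply: le_trans (nD _ _); rewrite addrC subrK.
apply: le_trans h1 _.
apply: le_trans (lerD (le_trans (rA y) (ler_wpM2l N0 h2)) (TC _)) _.
have h3 : C * normA A (x - A y) <= `|C| * d.
  apply: le_trans (ler_wpM2r (sqrtr_ge0 _) (ler_norm C)) _.
  by rewrite ler_wpM2l// ltW.
have h4 : op_normA A T * normA A (x - A y) <= op_normA A T * d.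
  by rewrite ler_wpM2l// ltW.
have : (op_normA A T + `|C| + 1) * d = e by rewrite /d mulrC divfK// gt_eqF.
move: h3 h4; rewrite mulrDr.
move: (op_normA A T) (normA A x) (normA A (x - A y)) => *; nra.
Qed.

End PositiveOperator.

Lemma unimodular_mul (R : realType) (z : R[i]) :
  exists2 c : R[i], `|c| = 1 & c * z = `|z|.
Proof.
have [->|z0] := eqVneq z 0; first by exists 1; rewrite ?normr1// mulr0 normr0.
exists (`|z| / z); last by rewrite divfK.
by rewrite normrM normfV normr_id divff// normr_eq0.
Qed.

(** * Rotation by a phase, and the numerical radius bound *)

Section Rotation.
Context {R : realType} {H : hilbertType R} {A : {linear H -> H}}.
Implicit Types (x y : H) (c : R[i]).

Lemma innerAZr c x y : innerA A x (c^* *: y) = c * innerA A x y.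
Proof. by rewrite /innerA linearZr_LR /= conjCK. Qed.

Lemma normAZ c x : `|c| = 1 -> normA A (c *: x) = normA A x.
Proof.
move=> c1; rewrite /normA /innerA [A _]linearZ /= linearZl_LR linearZr_LR /=.
by rewrite mulrA -normCK c1 expr1n mul1r.
Qed.

End Rotation.

Theorem theorem3p7 (R : realType) (H : hilbertType R) (A T1 T2 : {linear H -> H})
    (hA : positive_op A) (hT1 : in_LA A T1) (hT2 : in_LA A T2) :
  num_radiusA A (T1 \o T2) <=
    1 / 2 * (op_normA A (T2 \o T1) + op_normA A T1 * op_normA A T2).
Proof.
have [S1 [_ TS1]] := in_LA_adj hA hT1; have [S2 [_ TS2]] := in_LA_adj hA hT2.
have [C1 TC1] := in_LA_bounded hA hT1; have [C2 TC2] := in_LA_bounded hA hT2.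
have N1 := op_normA_ge0 A T1; have N2 := op_normA_ge0 A T2.
have N21 := op_normA_ge0 A (T2 \o T1).
have TC21 x : normA A ((T2 \o T1) x) <= `|C2| * `|C1| * normA A x.
  apply: le_trans (TC2 _) _.
  apply: le_trans (ler_wpM2r (sqrtr_ge0 _) (ler_norm C2)) _.
  rewrite -mulrA ler_wpM2l//; apply: le_trans (TC1 _) _.
  by rewrite ler_wpM2r ?sqrtr_ge0// ler_norm.
rewrite /num_radiusA; set E := [set _ | _ in _].
(* Without vectors of A-seminorm 1 the numerical radius is the default value 0. *)
have [E0|/eqP E0] := pselect (E = set0).
  by rewrite E0 sup0 mulr_ge0 ?addr_ge0// mulr_ge0.
apply: ge_sup; first exact/set0P.
move=> _ [x /= x1 <-].
have [c c1 cz] := unimodular_mul (innerA A (T1 (T2 x)) x).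
(* The phase c turns <T1 T2 x, x>_A into its modulus and keeps all seminorm bounds; the conjugate
   phase enters the A-adjoint of c T1. *)
have := @adj_pair_product _ _ _ (formA_semi hA) (fun u => c *: T1 u)
  (fun v => S1 (c^* *: v)) T2 S2 _ _ _ x _ _ N1 N2 N21.
have -> : 2 * formA (A := A) (c *: T1 (T2 x)) x =
    2 * complex.Re `|innerA A (T1 (T2 x)) x|.
  by rewrite -cz /formA /innerA [A _]linearZ /= linearZl_LR.
rewrite (formA_sqr hA) x1 expr1n mulr1 => h.
rewrite mul1r mulrC ler_pdivlMr// mulrC; apply: h => [u v|u v|u|u|u].
- by rewrite /formA -TS1 innerAZr /innerA [A _]linearZ /= linearZl_LR.
- by rewrite /formA TS2.
- by have := op_normA_le hA TC1 u; rewrite -(normAZ (A := A) (T1 u) c1).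
- by have := op_normA_le hA TC2 u.
- have := op_normA_le hA TC21 u; rewrite /= linearZ /=.
  by rewrite -(normAZ (A := A) (T2 (T1 u)) c1).
Qed.
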